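(* Let $G$ be a finite group that does not have a non-commutative Frobenius complement as a quotient (i.e. no quotient group of $G$ is isomorphic to a non-commutative Frobenius complement). Let $e_1,\dots,e_n$ be the primitive central idempotents of $\mathbb{Q}G$ and write $\mathbb{Q}Ge_i\cong M_{n_i}(D_i)$ with $D_i$ a division algebra. Then: (a) $\mathbb{Q}G$ has no simple component which is a non-commutative division ring; (b) for each $i\in\{1,\dots,n\}$ such that either $n_i>2$, or $n_i=2$ and $D_i$ is different from $\mathbb{Q}$, from a quadratic imaginary extension of $\mathbb{Q}$ and from a totally definite quaternion algebra over $\mathbb{Q}$, there exists $g_i\in G\setminus\{1\}$ with $\widehat{g_i}e_i\notin\{0,e_i\}$.
   Context: A finite group $\Gamma$ is a Frobenius group if it contains a proper non-trivial subgroup $H$ such that $H\cap H^g=\{1\}$ for all $g\in\Gamma\setminus H$; the group $H$ is then called a Frobenius complement in $\Gamma$. A group is a Frobenius complement if it is isomorphic to such an $H$ for some Frobenius group $\Gamma$. The simple components of $\mathbb{Q}G$ are the algebras $\mathbb{Q}Ge_i$. For $g\in G$ of order $m$, $\widehat{g}=\frac1m\sum_{k=0}^{m-1}g^k\in\mathbb{Q}G$. A totally definite quaternion algebra over $\mathbb{Q}$ is a quaternion algebra with center $\mathbb{Q}$ whose tensor product with $\mathbb{R}$ over $\mathbb{Q}$ is a division algebra. *)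

(* Defs.v *)
From HB Require Import structures.
From mathcomp Require Import all_boot all_order all_algebra all_fingroup.
From mathcomp Require Import all_solvable all_field all_character reals.

Set Implicit Arguments.
Unset Strict Implicit.
Unset Printing Implicit Defensive.

Import GRing.Theory Num.Theory.

Local Open Scope ring_scope.

Definition isom_Frobenius_complement (gT : finGroupType) (K : {group gT}) :=
  exists (rT : finGroupType) (Gamma H : {group rT}),
    [Frobenius Gamma with complement H]%g /\ (K \isog H)%g.

(* The group algebra QG is the row space of group_ring rat G, a copy of QG    *)
(* inside 'M_#|G|: g \in G is encoded as regular_repr rat G g, the product is *)
(* *m and the unit is 1%:M.                                                   *)
Section RationalGroupAlgebra.

Variables (gT : finGroupType) (G : {group gT}).
Implicit Types (e f x y : 'M[rat]_#|G|).

Local Notation QG := (group_ring rat G).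
Local Notation ZQG := ('Z(QG)%MS).

Definition central_idempotent e := (e \in ZQG)%MS /\ e *m e = e.

Definition primitive_central_idempotent e :=
  [/\ central_idempotent e, e != 0 &
      forall e1 e2, central_idempotent e1 -> central_idempotent e2 ->
        e1 *m e2 = 0 -> e = e1 + e2 -> e1 = 0 \/ e2 = 0].

Definition component e : pred 'M[rat]_#|G| :=
  [pred x | (x \in QG)%MS && (x *m e == x)].

Definition component_commutative e := {in component e &, commutative mulmx}.

(* The unit of the component is e. *)
Definition component_division_ring e :=
  e != 0 /\
  {in component e, forall x, x != 0 ->
     exists2 y, y \in component e & y *m x = e /\ x *m y = e}.

(* phi is only relevant on the component; it preserves the unit because it is *)
(* multiplicative and onto.                                                   *)
Definition component_isom_matrix e (n : nat) (D : nzRingType) :=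
  exists phi : 'M[rat]_#|G| -> 'M[D]_n,
    [/\ {in component e &, {morph phi : x y / x + y}},
        {in component e &, {morph phi : x y / x *m y}},
        {in component e &, injective phi} &
        forall A, exists2 x, x \in component e & phi x = A].

Definition hat (g : gT) : 'M[rat]_#|G| :=
  (#[g]%g%:R)^-1 *: \sum_(k < #[g]%g) regular_repr rat G (g ^+ k)%g.

End RationalGroupAlgebra.

Arguments primitive_central_idempotent {gT} G e.
Arguments component {gT} G e.
Arguments component_commutative {gT} G e.
Arguments component_division_ring {gT} G e.
Arguments component_isom_matrix {gT} G e n D.
Arguments hat {gT} G g.

Definition division_algebra (F : fieldType) (D : falgType F) :=
  forall x : D, x != 0 -> x \is a GRing.unit.

Definition ring_isom (A B : nzRingType) :=
  exists phi : {rmorphism A -> B}, bijective phi.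

(* The tensor product A (x)_Q R, with coordinates in R along the Q-basis      *)
(* (b_i (x) 1)_i, where (b_i)_i is vbasis {:A}.                               *)
Definition tensor_real (R : realType) (A : falgType rat) : Type :=
  'rV[R]_(\dim {:A}).

Section TensorReal.

Variables (R : realType) (A : falgType rat).

Local Notation T := (tensor_real R A).
Local Notation d := (\dim {:A}).
Local Notation b := (vbasis {:A}).

HB.instance Definition _ := Vector.on T.

Definition tensor_inl (a : A) : T := \row_(k < d) ratr (coord b k a).

Definition tensor_mul (u v : T) : T :=
  \sum_(i < d) \sum_(j < d) (u 0 i * v 0 j) *: tensor_inl (b`_i * b`_j).

Lemma tensor_inl_lin (I : Type) (r : seq I) (c : I -> rat) (a : I -> A) :
  tensor_inl (\sum_(i <- r) c i *: a i)
    = \sum_(i <- r) ratr (c i) *: tensor_inl (a i).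
Proof.
apply/rowP => k; rewrite mxE summxE !linear_sum /= rmorph_sum /=.
by apply: eq_bigr => i _; rewrite !mxE linearZ /= rmorphM.
Qed.

Lemma tensor_inl_basis (i : 'I_d) : tensor_inl b`_i = delta_mx 0 i.
Proof.
apply/rowP => k; rewrite !mxE eqxx /= coord_free ?rmorph_nat //.
  by rewrite eq_sym.
exact: basis_free (vbasisP _).
Qed.

Lemma tensorE (u : T) : u = \sum_(i < d) u 0 i *: tensor_inl b`_i.
Proof.
by rewrite [LHS]row_sum_delta; apply: eq_bigr => i _; rewrite tensor_inl_basis.
Qed.

Lemma tensor_mulDl : left_distributive tensor_mul +%R.
Proof.
move=> u v w; rewrite -big_split; apply: eq_bigr => i _; rewrite -big_split.
by apply: eq_bigr => j _; rewrite mxE mulrDl scalerDl.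
Qed.

Lemma tensor_mulDr : right_distributive tensor_mul +%R.
Proof.
move=> u v w; rewrite -big_split; apply: eq_bigr => i _; rewrite -big_split.
by apply: eq_bigr => j _; rewrite mxE mulrDr scalerDl.
Qed.

Lemma tensor_mulZl c u v : tensor_mul (c *: u) v = c *: tensor_mul u v.
Proof.
rewrite scaler_sumr; apply: eq_bigr => i _; rewrite scaler_sumr.
by apply: eq_bigr => j _; rewrite mxE scalerA mulrA.
Qed.

Lemma tensor_mulZr c u v : tensor_mul u (c *: v) = c *: tensor_mul u v.
Proof.
rewrite scaler_sumr; apply: eq_bigr => i _; rewrite scaler_sumr.
by apply: eq_bigr => j _; rewrite mxE scalerA mulrCA.
Qed.

Lemma tensor_mul_inl a a' :
  tensor_mul (tensor_inl a) (tensor_inl a') = tensor_inl (a * a').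
Proof.
rewrite {2}(coord_vbasis (memvf a)) {2}(coord_vbasis (memvf a')) mulr_suml.
under [in RHS]eq_bigr => i _ do rewrite -scalerAl.
rewrite tensor_inl_lin; apply: eq_bigr => i _.
rewrite mulr_sumr.
under [in RHS]eq_bigr => j _ do rewrite -scalerAr.
rewrite tensor_inl_lin scaler_sumr; apply: eq_bigr => j _.
by rewrite scalerA !mxE.
Qed.

Lemma tensor_mul_suml I (r : seq I) (F : I -> T) v :
  tensor_mul (\sum_(i <- r) F i) v = \sum_(i <- r) tensor_mul (F i) v.
Proof.
apply: (big_morph (tensor_mul^~ v)) => [x y|]; first exact: tensor_mulDl.
by have:= tensor_mulZl 0 0 v; rewrite !scale0r.
Qed.

Lemma tensor_mul_sumr I (r : seq I) (F : I -> T) v :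
  tensor_mul v (\sum_(i <- r) F i) = \sum_(i <- r) tensor_mul v (F i).
Proof.
apply: (big_morph (tensor_mul v)) => [x y|]; first exact: tensor_mulDr.
by have:= tensor_mulZr 0 v 0; rewrite !scale0r.
Qed.

Lemma tensor_mulA : associative tensor_mul.
Proof.
have h3 a a' w : tensor_mul (tensor_inl a) (tensor_mul (tensor_inl a') w)
    = tensor_mul (tensor_mul (tensor_inl a) (tensor_inl a')) w.
  rewrite (tensorE w) (tensor_mul_sumr _ _ (tensor_inl a')) !tensor_mul_sumr.
  apply: eq_bigr => k _.
  by rewrite !tensor_mulZr !tensor_mul_inl mulrA.
have h2 a v w : tensor_mul (tensor_inl a) (tensor_mul v w)
    = tensor_mul (tensor_mul (tensor_inl a) v) w.
  rewrite (tensorE v) tensor_mul_suml !(tensor_mul_sumr _ _ (tensor_inl a)).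
  rewrite tensor_mul_suml; apply: eq_bigr => j _.
  by rewrite tensor_mulZl !tensor_mulZr tensor_mulZl h3.
move=> u v w; rewrite (tensorE u) (tensor_mul_suml _ _ v) !tensor_mul_suml.
apply: eq_bigr => i _.
by rewrite !tensor_mulZl h2.
Qed.

Lemma tensor_mul1l : left_id (tensor_inl 1) tensor_mul.
Proof.
move=> u; rewrite [in LHS](tensorE u) [RHS]tensorE tensor_mul_sumr.
by apply: eq_bigr => i _; rewrite tensor_mulZr tensor_mul_inl mul1r.
Qed.

Lemma tensor_mul1r : right_id (tensor_inl 1) tensor_mul.
Proof.
move=> u; rewrite [in LHS](tensorE u) [RHS]tensorE tensor_mul_suml.
by apply: eq_bigr => i _; rewrite tensor_mulZl tensor_mul_inl mulr1.
Qed.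

Lemma tensor_inl1_neq0 : tensor_inl 1 != 0.
Proof.
apply/eqP => /rowP h1; have /eqP[] := oner_neq0 A.
rewrite (coord_vbasis (memvf 1)) big1 // => i _.
by move/eqP: (h1 i); rewrite !mxE fmorph_eq0 => /eqP->; rewrite scale0r.
Qed.

HB.instance Definition _ := GRing.Zmodule_isNzRing.Build T
  tensor_mulA tensor_mul1l tensor_mul1r tensor_mulDl tensor_mulDr
  tensor_inl1_neq0.

Fact tensor_scalerAl (c : R) (u v : T) : c *: (u * v) = (c *: u) * v.
Proof. by rewrite [RHS]tensor_mulZl. Qed.

HB.instance Definition _ :=
  GRing.Lmodule_isLalgebra.Build R T tensor_scalerAl.

Fact tensor_scalerAr (c : R) (u v : T) : c *: (u * v) = u * (c *: v).
Proof. by rewrite [RHS]tensor_mulZr. Qed.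

HB.instance Definition _ := GRing.Lalgebra_isAlgebra.Build R T tensor_scalerAr.
HB.instance Definition _ := Algebra_isFalgebra.Build R T.

End TensorReal.

(* K = Q(x) with x a square root of a negative rational. *)
Definition imaginary_quadratic (K : fieldExtType rat) :=
  \dim {:K} = 2 /\ exists (x : K) (c : rat), c < 0 /\ x ^+ 2 = c%:A.

(* D is (a, b / Q) for some nonzero a and b; its centre is then Q. *)
Definition rational_quaternion_algebra (D : falgType rat) :=
  exists (a b : rat) (i j : D),
    [/\ a != 0, b != 0, i ^+ 2 = a%:A, j ^+ 2 = b%:A & j * i = - (i * j)]
    /\ basis_of {:D} [:: 1; i; j; i * j].

Definition totally_definite_quaternion (R : realType) (D : falgType rat) :=
  rational_quaternion_algebra D /\ division_algebra (tensor_real R D).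

(* Main.v *)
(* If every hat g e is 0 or e, let N be the set of g in G with g e = e. Outside *)
(* N the element g fixes no nonzero vector of QGe, and this survives reduction *)
(* modulo a large prime p: G / N acts without fixed points on a nonzero vector *)
(* space V over F_p, so it is trivial or a complement in the Frobenius group   *)
(* V ><| G / N. By hypothesis G / N is then abelian, hence so is QGe. For (a), *)
(* hat g e is an idempotent of a division ring; for (b), a failure would make  *)
(* M_n(D) commutative with n > 1.                                              *)

Require Import Defs.
From HB Require Import structures.
From mathcomp Require Import all_boot all_order all_algebra all_fingroup.
From mathcomp Require Import all_solvable all_field all_character reals zify.

Set Implicit Arguments.
Unset Strict Implicit.
Unset Printing Implicit Defensive.

Import GRing.Theory Num.Theory.

Local Open Scope ring_scope.

(** Fix a primitive central idempotent [e] and suppose that each [hat G g *m e] is [0] or [e]. As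
    [hat G g] projects onto the vectors fixed by [g], each [g] either fixes no nonzero vector of QGe
    or acts on it trivially. A finite model of this action, obtained modulo a large prime in
    [hat_dichotomy_quotient], shows that G modulo the kernel is trivial or a Frobenius complement.
    By hypothesis it is then abelian, which makes QGe commutative ([hat_dichotomy_commutative]). The
    dichotomy holds in a division ring, whose only idempotents are 0 and 1
    ([component_division_hat]); this gives (a). For (b), its failure yields the required [g], since
    a matrix ring of size above 1 is not commutative ([matrix_ring_noncommutative]). *)

(** The semidirect product of the finite space of row vectors by [G] is a Frobenius group: a vector
    commuting with [a] there is one fixed by [rG a]. *)
Lemma fixfree_repr_Frobenius_complement (F : finFieldType)
    (gT : finGroupType) (G : {group gT}) (n : nat)
    (rG : mx_representation F G n) :
    (0 < n)%N -> G :!=: 1%g ->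
    {in G^#%g, forall g (v : 'rV_n), v *m rG g = v -> v = 0} ->
  isom_Frobenius_complement G.
Proof.
case: n rG => // n rG _ ntG fixfree; pose to := ('MR rG)%gact.
exists (sdprod_groupType to), [set: sdprod_groupType to]%G.
exists (sdpair2 to @* G)%G; split; last first.
  by apply: sub_isog => //; apply: injm_sdpair2.
suff: [Frobenius setT = sdpair1 to @* setT ><| sdpair2 to @* G]%g.
  exact: FrobeniusWcompl.
apply/(Frobenius_semiregularP (sdprod_sdpair to)).
- rewrite morphim_injm_eq1 ?injm_sdpair1 //.
  (* The dimension is now a successor, so the all-ones vector is nonzero. *)
  apply/trivgPn; exists (const_mx 1); first by rewrite inE.
  by apply/eqP=> /rowP/(_ 0)/eqP; rewrite !mxE oner_eq0.
- by rewrite morphim_injm_eq1 ?injm_sdpair2.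
move=> b /setD1P[nt_a /morphimP[a _ Ga def_b]]; rewrite {b}def_b in nt_a *.
apply/trivgP/subsetP=> _ /setIP[/morphimP[v _ _ ->] /cent1P cav].
have{}nt_a: a \in (G^#)%g.
  by rewrite !inE Ga andbT; apply: contraNneq nt_a => ->; rewrite morph1.
suffices ->: v = 1%g by rewrite morph1 inE.
apply: (fixfree a nt_a).
have: sdpair1 to (to v a) = sdpair1 to v.
  by rewrite sdpair_act ?inE // conjgE cav mulKg.
move/(injmP (injm_sdpair1 to)) => /(_ (in_setT _) (in_setT _)).
by rewrite /= mx_repr_actE.
Qed.

Lemma rat_matrix_scale m n (A : 'M[rat]_(m, n)) :
  exists (d : int) (B : 'M[int]_(m, n)),
    d != 0 /\ map_mx intr B = d%:~R *: A.
Proof.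
(* The common denominator is the product of the denominators of all entries. *)
exists (\prod_k denq (A k.1 k.2)).
exists (\matrix_(i, j)
  (numq (A i j) * \prod_(k | k != (i, j)) denq (A k.1 k.2))).
split; first by apply/prodf_neq0 => k _; apply: denq_neq0.
apply/matrixP=> i j; rewrite !mxE [in RHS](bigD1 (i, j)) //=.
by rewrite !rmorphM /= numqE -[LHS]mulrA [LHS]mulrC.
Qed.

Lemma intr_Fp_neq0 p (z : int) :
  prime p -> (0 < `|z| < p)%N -> (z%:~R : 'F_p) != 0.
Proof.
move=> pr_p /andP[z_gt0 ltzp].
rewrite [z]intEsign rmorphM /= rmorph_sign mulf_neq0 ?signr_eq0 //=.
by rewrite -(dvdn_pcharf (pchar_Fp pr_p)) gtnNdvd.
Qed.

Section Hat.

Variables (gT : finGroupType) (G : {group gT}).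
Local Notation aG := (regular_repr rat G).

Lemma hat_mull g : g \in G -> aG g *m hat G g = hat G g.
Proof.
move=> Gg; rewrite /hat -scalemxAr; congr (_ *: _).
rewrite mulmx_sumr; have := order_gt0 g.
case def_m: #[g]%g => [|m] // _.
(* Multiplication by [g] shifts the powers cyclically: the last one wraps around to the identity. *)
rewrite big_ord_recr [in RHS]big_ord_recl /= addrC.
rewrite -repr_mxM ?groupX // -expgS -def_m expg_order; congr (_ + _).
by apply: eq_bigr => k _; rewrite -repr_mxM ?groupX // -expgS.
Qed.

Lemma hat_idem g : g \in G -> hat G g *m hat G g = hat G g.
Proof.
move=> Gg; rewrite {1}/hat -scalemxAl mulmx_suml.
have hatX k : aG (g ^+ k)%g *m hat G g = hat G g.
  elim: k => [|k IHk]; first by rewrite repr_mx1 mul1mx.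
  by rewrite expgS repr_mxM ?groupX // -mulmxA IHk hat_mull.
under eq_bigr do rewrite hatX.
rewrite sumr_const card_ord.
rewrite -scaler_nat scalerA mulVf ?scale1r //.
by rewrite pnatr_eq0 -lt0n order_gt0.
Qed.

Lemma hat_group_ring g : g \in G -> (hat G g \in group_ring rat G)%MS.
Proof.
move=> Gg; rewrite /hat linearZ /= linear_sum.
by apply/scalemx_sub/summx_sub => k _; apply: envelop_mx_id; rewrite groupX.
Qed.

Lemma hat_fix (e : 'M_#|G|) g :
  g \in G -> hat G g *m e = e -> aG g *m e = e.
Proof. by move=> Gg he; rewrite -{1}he mulmxA hat_mull. Qed.

End Hat.

(** [N] is the kernel of the action on the row space of an integral multiple of [e] reduced modulo
    [p]. *)
Lemma hat_dichotomy_quotient (gT : finGroupType) (G : {group gT})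
    (e : 'M[rat]_#|G|) :
    central_idempotent e -> e != 0 ->
    {in G, forall g, hat G g *m e = 0 \/ hat G g *m e = e} ->
  exists N : {group gT},
    [/\ (N <| G)%g, {in N, forall g, regular_repr rat G g *m e = e} &
        (G / N = 1)%g \/ isom_Frobenius_complement (G / N)%G].
Proof.
move=> [/center_mxP[QGe cGe] ee] nz_e dich.
have [d [E [nz_d defE]]] := rat_matrix_scale e.
have inj_int : injective (map_mx intr : 'M[int]_#|G| -> 'M[rat]_#|G|).
  move=> A B /matrixP eqAB; apply/matrixP=> i j.
  by have:= eqAB i j; rewrite !mxE => /intr_inj.
(* E need not be idempotent: only E ^ 2 = d E survives, so p must not divide d. *)
have EE : E *m E = d *: E.
  apply: inj_int; rewrite map_mxM map_mxZ /= defE.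
  by rewrite -scalemxAl -scalemxAr ee.
have cE g : g \in G -> E *m regular_mx int G g = regular_mx int G g *m E.
  move=> Gg; apply: inj_int; rewrite !map_mxM /= defE map_regular_mx.
  by rewrite -scalemxAl -scalemxAr (cGe (regular_mx rat G g)) ?envelop_mx_id.
have hatE g : g \in G -> hat G g *m e = 0 ->
    (\sum_(k < #[g]%g) regular_mx int G (g ^+ k)%g) *m E = 0.
  move=> Gg; rewrite /hat -scalemxAl => /eqP; rewrite scaler_eq0 invr_eq0.
  rewrite pnatr_eq0 eqn0Ngt order_gt0 /= => /eqP hge.
  apply: inj_int; rewrite map_mxM /= defE -scalemxAr map_mx0 raddf_sum /=.
  under eq_bigr do rewrite map_regular_mx.
  by rewrite hge scaler0.
have /matrix0Pn[i [j nzEij]] : E != 0.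
  apply: contraNneq nz_e => E0; move/eqP: defE; rewrite E0 map_mx0 eq_sym.
  by rewrite scaler_eq0 intr_eq0 (negPf nz_d).
(* Such a [p] divides neither [d] nor any element order, and [E] stays nonzero modulo [p]. *)
have [p ltp pr_p] := prime_above (#|G| + `|d| + `|E i j|).
have dp : (d%:~R : 'F_p) != 0.
  by apply: intr_Fp_neq0; rewrite // absz_gt0 nz_d; lia.
pose M : 'M['F_p]_#|G| := map_mx intr E.
have nzM : M != 0.
  apply/matrix0Pn; exists i, j; rewrite mxE intr_Fp_neq0 //.
  by rewrite absz_gt0 nzEij; lia.
have modM : mxmodule (regular_repr 'F_p G) M.
  apply/mxmoduleP=> g Gg; rewrite /= -(map_regular_mx intr) -map_mxM /= cE //.
  by rewrite map_mxM submxMl.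
pose rG := submod_repr modM.
have fixfree g (v : 'rV['F_p]_(\rank M)) :
  g \in G -> hat G g *m e = 0 -> v *m rG g = v -> v = 0.
  move=> Gg hge vg.
  apply: val_submod_inj; rewrite linear0; set w := val_submod v.
  have wg : w *m regular_repr 'F_p G g = w by rewrite -(val_submodJ modM) // vg.
  have wgX k : w *m regular_repr 'F_p G (g ^+ k)%g = w.
    elim: k => [|k IHk]; first by rewrite repr_mx1 mulmx1.
    by rewrite expgS repr_mxM ?groupX // mulmxA wg.
  have [u def_w] := submxP (val_submodP v : (w <= M)%MS).
  (* On its own row space [M] acts as the scalar [d]. Multiplying the fixed vector [w] by the
     relation [hatE] then gives [#[g] * d * w = 0], where both factors are invertible modulo [p]. *)
  have wM : w *m M = d%:~R *: w.
    by rewrite {1}def_w -mulmxA -map_mxM EE map_mxZ -scalemxAr -def_w.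
  have := congr1 (fun A => w *m map_mx intr A) (hatE g Gg hge).
  rewrite map_mxM raddf_sum /= map_mx0 mulmx0 mulmxA mulmx_sumr.
  under eq_bigr do rewrite map_regular_mx wgX.
  rewrite sumr_const card_ord -scaler_nat -scalemxAl wM => /eqP.
  rewrite !scaler_eq0 (negPf dp) /= -(dvdn_pcharf (pchar_Fp pr_p)) gtnNdvd //=.
    by move/eqP.
  by rewrite (leq_ltn_trans (dvdn_leq _ (order_dvdG Gg))) ?cardG_gt0 //; lia.
exists (rker rG); split; first exact: rker_normal.
  move=> g /rkerP[Gg rg1]; apply: hat_fix => //.
  (* If [hat G g *m e = 0], then [g] fixes only zero; being in the kernel, it would force
     [M = 0]. *)
  case: (dich g Gg) => // hge; case/negP: nzM; rewrite -mxrank_eq0.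
  have all0 (v : 'rV['F_p]_(\rank M)) : v = 0.
    by apply: (fixfree g) => //; rewrite rg1 mulmx1.
  rewrite -(mxrank1 'F_p (\rank M)) mxrank_eq0.
  by apply/eqP/row_matrixP=> k; rewrite row0; apply: all0.
have [|ntGN] := eqVneq (G / rker rG)%g 1%g; [by left | right].
have : {in (G / rker rG)^#%g, forall x (v : 'rV['F_p]_(\rank M)),
    v *m kquo_repr rG x = v -> v = 0}.
  move=> x /setD1P[ntx /morphimP[g Ng Gg def_x]] v; rewrite def_x.
  rewrite kquo_repr_coset // => vg.
  case: (dich g Gg) => [hge | hge]; first exact: (fixfree g).
  (* If [hat G g *m e = e], then [g] fixes [e], hence [E] and its reduction [M], so [g] lies in the
     kernel. *)
  case/eqP: ntx; rewrite def_x; apply: coset_id.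
  apply/rkerP; split=> //.
  apply: val_submod_inj; rewrite -[submod_repr modM g]mul1mx val_submodJ //.
  have /submxP[u ->] := val_submodP (1%:M : 'M_(\rank M)).
  rewrite -mulmxA; congr (_ *m _).
  rewrite /= -(map_regular_mx intr) -map_mxM; congr (map_mx _ _).
  apply: inj_int; rewrite cE // map_mxM /= defE map_regular_mx -scalemxAr.
  by congr (_ *: _); apply: hat_fix.
move/fixfree_repr_Frobenius_complement; apply=> //.
by rewrite lt0n mxrank_eq0.
Qed.

Lemma hat_dichotomy_commutative (gT : finGroupType) (G : {group gT})
    (e : 'M[rat]_#|G|) :
    (forall N : {group gT}, (N <| G)%g ->
       ~ (isom_Frobenius_complement (G / N)%G /\ ~~ abelian (G / N)%g)) ->
    primitive_central_idempotent G e ->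
    {in G, forall g, hat G g *m e = 0 \/ hat G g *m e = e} ->
  component_commutative G e.
Proof.
move=> noFrob [ce nz_e _] dich.
have [N [nsNG Ne GN]] := hat_dichotomy_quotient ce nz_e dich.
have cGN : abelian (G / N)%g.
  case: GN => [-> | FGN]; first exact: abelian1.
  by apply/negPn/negP => nab; apply: (noFrob N nsNG).
have [/center_mxP[QGe cGe] ee] := ce.
pose aG := regular_repr rat G.
have comm_e g h : g \in G -> h \in G -> aG (g * h)%g *m e = aG (h * g)%g *m e.
  move=> Gg Gh; rewrite [(g * h)%g]commgC (repr_mxM _ (groupM Gh Gg)) ?groupR // -mulmxA.
  by rewrite Ne // (subsetP (der1_min (normal_norm nsNG) cGN)) ?mem_commg.
move=> x y /andP[QGx /eqP xe] /andP[QGy /eqP ye].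
(* A factor [e] is inserted at the right of both products, so that [comm_e] applies after expansion
   along group elements. *)
rewrite -{1}ye -{2}xe !mulmxA.
have [a ->] := envelop_mxP QGx; have [b ->] := envelop_mxP QGy.
rewrite !mulmx_suml; under eq_bigr do rewrite mulmx_sumr mulmx_suml.
under [RHS]eq_bigr do rewrite mulmx_sumr mulmx_suml.
rewrite exchange_big /=; apply: eq_bigr => h Gh; apply: eq_bigr => g Gg.
rewrite -!scalemxAl -!scalemxAr -!scalemxAl !scalerA mulrC.
by congr (_ *: _); rewrite -!repr_mxM // comm_e.
Qed.

Lemma matrix_ring_noncommutative (D : nzRingType) (n : nat) :
  (1 < n)%N -> ~ commutative (@mulmx D n n n).
Proof.
move=> n_gt1 comm; pose i := Ordinal (ltnW n_gt1); pose j := Ordinal n_gt1.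
have /matrixP/(_ i i)/eqP := comm (delta_mx i j) (delta_mx j i).
(* The two products are the diagonal matrix units at [i] and at [j]; they differ at entry
   [(i, i)]. *)
by rewrite !mul_delta_mx !mxE /= oner_eq0.
Qed.

Lemma component_division_hat (gT : finGroupType) (G : {group gT})
    (e : 'M[rat]_#|G|) :
    central_idempotent e -> component_division_ring G e ->
  {in G, forall g, hat G g *m e = 0 \/ hat G g *m e = e}.
Proof.
move=> [/center_mxP[QGe cGe] ee] [_ div_e] g Gg; set f := hat G g *m e.
have [-> | nz_f] := eqVneq f 0; [by left | right].
have fe : f *m e = f by rewrite -mulmxA ee.
have ef : e *m f = f by rewrite /f mulmxA -cGe ?hat_group_ring // -mulmxA ee.
have ff : f *m f = f by rewrite {1}/f -mulmxA ef mulmxA hat_idem.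
have QGf : f \in component G e.
  by rewrite inE fe eqxx andbT envelop_mxM ?hat_group_ring.
have [y _ [yf _]] := div_e f QGf nz_f.
(* Cancelling the nonzero idempotent [f]: [f = e f = y f f = y f = e]. *)
by rewrite -{1}ef -yf -mulmxA ff.
Qed.

Theorem mainTheorem5 (R : realType) (gT : finGroupType) (G : {group gT})
  (noFrob : forall N : {group gT}, (N <| G)%g ->
     ~ (isom_Frobenius_complement (G / N)%G /\ ~~ abelian (G / N)%g))
  (r : nat) (e : 'I_r -> 'M[rat]_#|G|)
  (e_inj : injective e)
  (eP : forall f : 'M[rat]_#|G|,
     primitive_central_idempotent G f <-> exists i : 'I_r, f = e i)
  (n : 'I_r -> nat) (D : 'I_r -> falgType rat)
  (D_div : forall i : 'I_r, division_algebra (D i))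
  (eD : forall i : 'I_r, component_isom_matrix G (e i) (n i) (D i)) :
  (forall i : 'I_r,
     ~ (component_division_ring G (e i) /\ ~ component_commutative G (e i)))
  /\
  (forall i : 'I_r,
     (2 < n i)%N \/
     [/\ n i = 2%N,
         ~ ring_isom (D i) rat,
         ~ (exists K : fieldExtType rat,
              imaginary_quadratic K /\ ring_isom (D i) K) &
         ~ totally_definite_quaternion R (D i)] ->
     exists2 g : gT, g \in (G^#)%g &
       hat G g *m e i != 0 /\ hat G g *m e i != e i).
Proof.
have e_prim i : primitive_central_idempotent G (e i) by apply/eP; exists i.
split=> i.
  move=> [div_e]; apply; apply: hat_dichotomy_commutative => //.
  by have [ce _ _] := e_prim i; apply: component_division_hat.
move=> n_i; have {n_i} n_gt1: (1 < n i)%N by case: n_i => [/ltnW | [->]].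
have [/exists_inP[g G1g /andP[]]|] := boolP
  [exists g in (G^#)%g, (hat G g *m e i != 0) && (hat G g *m e i != e i)].
  by exists g.
rewrite negb_exists_in => /forall_inP dich.
have [phi [_ phiM _ phi_onto]] := eD i.
case: (@matrix_ring_noncommutative (D i) (n i) n_gt1) => A B.
have [[x ex <-] [y ey <-]] := (phi_onto A, phi_onto B).
rewrite -!phiM //; congr (phi _).
apply: hat_dichotomy_commutative ex ey => // g Gg.
(* The assumed dichotomy covers only nontrivial elements; for [g = 1], [hat G g] is the unit. *)
have [-> | nt_g] := eqVneq g 1%g.
  by right; rewrite /hat order1 invr1 scale1r big_ord1 repr_mx1 mul1mx.
have := dich g; rewrite !inE nt_g Gg negb_and !negbK => /(_ isT).
by case/orP=> /eqP; [left | right].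
Qed.
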